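(* Let $(\mathcal{F}_t)$ be a filtration. Let $\varepsilon_t = \sigma_t z_t$ with $\sigma_t = \exp(H_t)$, $H_t = \bar{H}_t + h_t$, where $\bar{H}_t = E\{H_t\mid\mathcal{F}_{t-1}\}$ is $\mathcal{F}_{t-1}$-measurable, $(h_t)$ is i.i.d. with Laplace density $\frac{1}{2\Delta}\exp(-|x|/\Delta)$, $\Delta = E|h_t|>0$, and $(z_t)$ is i.i.d. $\mathcal{N}(0,1)$, with $z_t$, $h_t$ mutually independent and independent of $\mathcal{F}_{t-1}$. Then, conditionally on $\mathcal{F}_{t-1}$, $\varepsilon_t$ has probability density $$p_\varepsilon(\varepsilon_t\mid\mathcal{F}_{t-1}) = \frac{1}{4\sqrt{\pi}\Delta}\left(\sqrt{2}e^{\bar{H}_t}\right)^{-1/\Delta}\Gamma\!\left(\frac{1-1/\Delta}{2}, \frac{\varepsilon_t^2}{2e^{2\bar{H}_t}}\right)|\varepsilon_t|^{1/\Delta - 1} + \frac{1}{4\sqrt{\pi}\Delta}\left(\sqrt{2}e^{\bar{H}_t}\right)^{1/\Delta}\gamma\!\left(\frac{1+1/\Delta}{2}, \frac{\varepsilon_t^2}{2e^{2\bar{H}_t}}\right)|\varepsilon_t|^{-1/\Delta - 1}.$$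
   Context: $\Gamma(a,b) = \int_b^\infty x^{a-1}e^{-x}\,dx$ is the upper incomplete gamma function and $\gamma(a,b) = \int_0^b x^{a-1}e^{-x}\,dx$ is the lower incomplete gamma function. *)

(* Defs.v *)
From HB Require Import structures.
From mathcomp Require Import all_boot all_order all_algebra.
From mathcomp Require Import all_classical all_reals all_analysis.
Set Implicit Arguments. Unset Strict Implicit. Unset Printing Implicit Defensive.
Import Order.TTheory GRing.Theory Num.Theory.
Import numFieldNormedType.Exports.
Local Open Scope classical_set_scope.
Local Open Scope ring_scope.

Section defs.
Variable R : realType.
Local Open Scope ereal_scope.

Definition upper_gamma (a b : R) : \bar R :=
  \int[lebesgue_measure]_(x in `[b, +oo[%classic) (x `^ (a - 1) * expR (- x))%:E.

Definition lower_gamma (a b : R) : \bar R :=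
  \int[lebesgue_measure]_(x in `[0%R, b]%classic) (x `^ (a - 1) * expR (- x))%:E.

Definition laplace_pdf (D x : R) : R := (2 * D)^-1 * expR (- `|x| / D).

(* the claimed conditional density of eps_t at e, when Hbar_t = c *)
Definition eps_density (D c e : R) : \bar R :=
  ((4 * Num.sqrt pi * D)^-1 * (Num.sqrt 2 * expR c) `^ (- D^-1))%:E
    * upper_gamma ((1 - D^-1) / 2) (e ^+ 2 / (2 * expR (2 * c)))
    * (`|e| `^ (D^-1 - 1))%:E
  + ((4 * Num.sqrt pi * D)^-1 * (Num.sqrt 2 * expR c) `^ (D^-1))%:E
    * lower_gamma ((1 + D^-1) / 2) (e ^+ 2 / (2 * expR (2 * c)))
    * (`|e| `^ (- D^-1 - 1))%:E.
End defs.

Section prob_defs.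
Context {d : measure_display} {T : measurableType d} {R : realType}.
Local Open Scope ereal_scope.

Definition sub_sigma (G : set (set T)) : Prop :=
  sigma_algebra setT G /\ G `<=` measurable.

Definition filtration (F : nat -> set (set T)) : Prop :=
  (forall n, sub_sigma (F n)) /\ (forall n m, (n <= m)%N -> F n `<=` F m).

Definition G_measurable (G : set (set T)) (f : T -> R) : Prop :=
  forall B : set R, measurable B -> G (f @^-1` B).

Definition has_density (P : probability T R) (X : T -> R) (p : R -> R) : Prop :=
  forall B : set R, measurable B ->
    P (X @^-1` B) = \int[lebesgue_measure]_(x in B) (p x)%:E.

Definition indep_seq (P : probability T R) (X : nat -> T -> R) : Prop :=
  forall (s : seq nat) (B : nat -> set R), uniq s ->
    (forall i, measurable (B i)) ->
    P (\bigcap_(i in [set` s]) (X i @^-1` B i)) = \prod_(i <- s) P (X i @^-1` B i).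

Definition indep_pair_sigma (P : probability T R) (G : set (set T))
    (X Y : T -> R) : Prop :=
  forall (A : set T) (B C : set R), G A -> measurable B -> measurable C ->
    P (A `&` X @^-1` B `&` Y @^-1` C) = P A * P (X @^-1` B) * P (Y @^-1` C).
End prob_defs.

(* Main.v *)
Require Import Defs.
From HB Require Import structures.
From mathcomp Require Import all_boot all_order all_algebra.
From mathcomp Require Import all_classical all_reals all_analysis.
From mathcomp Require Import measurable_realfun ring lra.
Import Order.TTheory GRing.Theory Num.Theory.
Import numFieldNormedType.Exports.
Local Open Scope classical_set_scope.
Local Open Scope ring_scope.

(** Given the past, [eps = s z] with [s = exp (c + y)], [y] Laplace and [z]
    standard normal, so it has the scale mixture density
    [\int laplace y * phi (e / s) / s dy] (scaling of Lebesgue measure and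
    Tonelli).  For [e <> 0] the substitution [x = b exp (- 2 y)] with
    [b = e ^ 2 / (2 exp (2 c))] turns [phi (e / s)] into a multiple of
    [exp (- x)]; it maps the half-line [y <= 0] to [x >= b] and [y >= 0] to
    [0 < x <= b], which gives the upper and the lower gamma term respectively.
    Independence makes the joint law of the past variable and of [(h, z)] a
    product measure on every event of the past, and integrating its sections
    yields the conditional statement. *)

(** * Integration against a density, and scaling of Lebesgue measure *)

Section integral_density.
Local Open Scope ereal_scope.
Import HBNNSimple.

(** The hypothesis on [nu] is the claim for indicators. Linearity extends it to simple functions,
    and monotone convergence along a simple approximation of [f] does the rest. *)
Lemma ge0_integral_density {d} {T : measurableType d} {R : realType}
    (mu nu : {measure set T -> \bar R}) (g : T -> R) (f : T -> \bar R) :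
  measurable_fun setT g -> (forall x, (0 <= g x)%R) ->
  (forall A, measurable A -> nu A = \int[mu]_(x in A) (g x)%:E) ->
  measurable_fun setT f -> (forall x, 0 <= f x) ->
  \int[nu]_x f x = \int[mu]_x (f x * (g x)%:E).
Proof.
move=> mg g0 nuE mf f0.
have mgE : measurable_fun setT (EFin \o g) by exact/measurable_EFinP.
pose h := nnsfun_approx measurableT mf.
have hf x : EFin \o h ^~ x @ \oo --> f x.
  by apply: cvg_nnsfun_approx => // y _; exact: f0.
have ndh x : {homo (fun n => (h n x)%:E) : n m / (n <= m)%N >-> n <= m}.
  by move=> n m nm; rewrite lee_fin; exact/lefP/nd_nnsfun_approx.
have -> : \int[nu]_x f x = limn (fun n => \int[nu]_x (h n x)%:E).
  rewrite -monotone_convergence//.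
  - by apply: eq_integral => x _; apply/esym/cvg_lim => //; exact: hf.
  - by move=> n; exact/measurable_EFinP/measurable_funP.
  - by move=> n x _; rewrite lee_fin.
have -> : \int[mu]_x (f x * (g x)%:E) =
    limn (fun n => \int[mu]_x ((h n x)%:E * (g x)%:E)).
  rewrite -monotone_convergence//.
  - apply: eq_integral => x _; apply/esym/cvg_lim => //.
    by apply: cvgeZr => //; exact: hf.
  - move=> n; apply: emeasurable_funM => //.
    exact/measurable_EFinP/measurable_funP.
  - by move=> n x _; rewrite mule_ge0// lee_fin.
  - by move=> x _ n m nm; rewrite lee_wpmul2r ?lee_fin//; exact: ndh.
congr (limn _); apply/funext => n.
transitivity (\int[nu]_x (\sum_(y \in range (h n))
    (y * \1_(h n @^-1` [set y]) x)%:E)).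
  by apply: eq_integral => x _; rewrite fimfunE -fsumEFin.
rewrite ge0_integral_fsum//; last 2 first.
- by move=> y; exact/measurable_EFinP/measurable_funM.
- by move=> y x _; exact: nnfun_muleindic_ge0.
transitivity (\int[mu]_x (\sum_(y \in range (h n))
    (y * \1_(h n @^-1` [set y]) x)%:E * (g x)%:E)); last first.
  apply: eq_integral => x _.
  rewrite -ge0_mule_fsuml => [|y]; last exact: nnfun_muleindic_ge0.
  by rewrite fsumEFin // -(fimfunE _ x).
rewrite ge0_integral_fsum//; last 2 first.
- move=> y; apply: emeasurable_funM => //.
  exact/measurable_EFinP/measurable_funM.
- by move=> y x _; apply: mule_ge0; [exact: nnfun_muleindic_ge0|rewrite lee_fin].
(* For a single value [r], both sides equal [r] times the [nu]-measure of its level set; on the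
   right this is [nuE]. *)
apply: eq_fsbigr => r rhn.
have r0 : (0 <= r)%R by move: rhn; rewrite inE => -[x _ <-].
under eq_integral do rewrite EFinM.
rewrite integralZl_indic_nnsfun => //.
under [RHS]eq_integral do rewrite EFinM -muleA.
rewrite ge0_integralZl//.
- under [in RHS]eq_integral do rewrite muleC.
  rewrite [in RHS](eq_integral ((EFin \o g) \_ (h n @^-1` [set r]))); last first.
    by move=> x _; rewrite epatch_indic.
  by rewrite -integral_mkcond integral_indic// setIT nuE.
- by apply: emeasurable_funM => //; exact/measurable_EFinP.
- by move=> t _; rewrite mule_ge0 ?lee_fin.
Qed.

(** Lebesgue measure is [s] times its own pushforward under [x -> s x], so changing variables costs
    the factor [s^-1]. *)
Lemma ge0_integral_scale {R : realType} (s : R) (f : R -> \bar R) (B : set R) :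
  (0 < s)%R -> measurable B -> measurable_fun setT f -> (forall x, 0 <= f x) ->
  \int[lebesgue_measure]_(x in (fun x => s * x)%R @^-1` B) f (s * x)%R =
  s^-1%:E * \int[lebesgue_measure]_(x in B) f x.
Proof.
move=> s0 mB mf f0.
pose phi (x : measurableTypeR R) : measurableTypeR R := (s * x)%R.
have mphi : measurable_fun setT phi by exact: measurable_funM.
pose mu' : {measure set (measurableTypeR R) -> \bar R} :=
  measure_function_pushforward__canonical__measure_function_Measure
    lebesgue_measure mphi.
pose k := NngNum (ltW s0).
(* By uniqueness of Lebesgue measure it suffices to compare on half-open intervals; the preimage of
   []a, b]] is []a / s, b / s]]. *)
have scaleE A : measurable A -> lebesgue_measure A = mscale k mu' A.
  apply: lebesgue_measure_unique => _ [[a b]] _ <-.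
  transitivity (s%:E * lebesgue_measure `](a / s)%R, (b / s)%R]%classic);
      last first.
    congr (_ * lebesgue_measure _); apply/seteqP.
    split=> x /=; rewrite !in_itv/= /phi;
    by rewrite ltr_pdivrMr// ler_pdivlMr// ![(s * x)%R]mulrC.
  rewrite !lebesgue_measure_itv/= !lte_fin ltr_pM2r ?invr_gt0//.
  case: ifPn => _; last by rewrite mule0.
  rewrite -!EFinD -EFinM; congr EFin.
  by rewrite -mulrBl mulrC divfK// gt_eqF.
transitivity (\int[mu']_(x in B) f x).
  by rewrite [RHS]ge0_integral_pushforward//; exact: measurable_funTS.
transitivity (s^-1%:E * \int[mscale k mu']_(x in B) f x); last first.
  by congr (_ * _); apply: eq_measure_integral => A mA _; exact/esym/scaleE.
rewrite ge0_integral_mscale//; last exact: measurable_funTS.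
by rewrite muleA -EFinM mulVf ?gt_eqF// mul1e.
Qed.

End integral_density.

(** * The exponential substitution in the incomplete gamma integrals *)

Section gamma_substitution.
Context {R : realType}.
Variables (a b : R).
Hypothesis b0 : 0 < b.
Let F (y : R) : R := b * expR (- (2 * y)).
(** The gamma integrand pulled back along [F]: the Jacobian [- F' = 2 F] raises the exponent from
    [a - 1] to [a]. *)
Let K (y : R) : R := 2 * F y `^ a * expR (- F y).

Let F_gt0 y : 0 < F y. Proof. by rewrite mulr_gt0// expR_gt0. Qed.

Let is_deriveF (y : R) : is_derive y (1:R) F (- 2 * F y).
Proof.
rewrite /F; apply: is_derive_eq.
by rewrite !scaler1 /GRing.scale/=; ring.
Qed.

Let derive1F : derive1 F = (fun y => - 2 * F y).
Proof.
apply/funext => y; rewrite derive1E.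
exact: (@derive_val _ _ _ _ _ _ _ (is_deriveF y)).
Qed.

Let continuousF : continuous F.
Proof.
move=> y; apply/differentiable_continuous/derivable1_diffP.
by have [] := is_deriveF y.
Qed.

Let continuous_gammaG (x : R) : 0 < x ->
  {for x, continuous (fun x : R => x `^ (a - 1) * expR (- x))}.
Proof.
move=> x0; have cpow : {for x, continuous (fun y : R => y `^ (a - 1))}.
  apply/differentiable_continuous/derivable1_diffP.
  by apply: derivable_powR; rewrite in_itv/= x0.
have cexp : {for x, continuous (fun y : R => expR (- y))}.
  by apply: continuous_comp; [exact: oppr_continuous|exact: continuous_expR].
exact: (cvgM cpow cexp).
Qed.

(** Substitution on a compact interval. [F] is strictly decreasing, so the endpoints swap; [F v > 0]
    keeps the interval away from the possible singularity of the power at 0. *)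
Let integral_gamma_itv (u v : R) : u <= v ->
  (\int[lebesgue_measure]_(x in `[F v, F u]) (x `^ (a - 1) * expR (- x))%:E =
   \int[lebesgue_measure]_(y in `[u, v]) (K y)%:E)%E.
Proof.
move=> uv; have cF' : continuous (derive1 F).
  by rewrite derive1F => y; apply: cvgM; [exact: cvg_cst|exact: continuousF].
rewrite integration_by_substitution_decreasing//.
- apply: eq_integral => y _; congr EFin => /=.
  rewrite fctE/= derive1F fctE /K mulNr opprK.
  have -> : F y `^ a = F y `^ (a - 1) * F y.
    rewrite -[X in _ = _ * X]powRr1; last exact: ltW.
    rewrite -powRD ?subrK//; apply/implyP => _.
    by rewrite gt_eqF// F_gt0.
  ring.
- by move=> x y _ _ xy; rewrite ltr_pM2l// ltr_expR ltrN2 ltr_pM2l.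
- by apply/cvg_ex; exists (derive1 F u); apply: cvg_at_right_filter; exact: cF'.
- by apply/cvg_ex; exists (derive1 F v); apply: cvg_at_left_filter; exact: cF'.
- split.
  + by move=> x _; have [] := is_deriveF x.
  + by apply: cvg_at_right_filter; exact: continuousF.
  + by apply: cvg_at_left_filter; exact: continuousF.
- apply: continuous_in_subspaceT => x; rewrite inE/= in_itv/= => /andP[+ _].
  by move=> /(lt_le_trans (F_gt0 _)); exact: continuous_gammaG.
Qed.

Let F0 : F 0 = b. Proof. by rewrite /F mulr0 oppr0 expR0 mulr1. Qed.

Let measurable_gammaG :
  measurable_fun setT (fun x : R => (x `^ (a - 1) * expR (- x))%:E).
Proof.
apply/measurable_EFinP; apply: measurable_funM => //.
exact: measurableT_comp.
Qed.

Let measurableK : measurable_fun setT (fun y : R => (K y)%:E).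
Proof.
have mF : measurable_fun setT F by exact: continuous_measurable_fun.
apply/measurable_EFinP; apply: measurable_funM; last first.
  by apply: measurableT_comp => //; exact: measurableT_comp.
apply: measurable_funM => //.
exact: (measurableT_comp (measurable_powR _)).
Qed.

Let K_ge0 y : 0 <= K y.
Proof. by rewrite /K !mulr_ge0// ?expR_ge0// powR_ge0. Qed.

(** Both integrands are nonnegative and the intervals increase with [n], so the two integrals are
    limits of the same sequence. Moving only [v] gives the lower gamma function, moving only [u] the
    upper one. *)
Let gamma_limit (u v : nat -> R) (A B : set R) :
  (forall n, u n <= v n) ->
  (forall n, u n.+1 <= u n) -> (forall n, v n <= v n.+1) ->
  \bigcup_n [set` `[F (v n), F (u n)]] = A ->
  \bigcup_n [set` `[u n, v n]] = B ->
  (\int[lebesgue_measure]_(x in A) (x `^ (a - 1) * expR (- x))%:E =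
   \int[lebesgue_measure]_(y in B) (K y)%:E)%E.
Proof.
move=> uv ud vi <- <-.
have nu : {homo u : n m / (n <= m)%N >-> m <= n}.
  by apply/nonincreasing_seqP.
have nv : {homo v : n m / (n <= m)%N >-> n <= m}.
  by apply/nondecreasing_seqP.
have leF y z : y <= z -> F z <= F y.
  by move=> yz; rewrite ler_pM2l// ler_expR lerN2 ler_pM2l.
have cvgA : (\int[lebesgue_measure]_(x in [set` `[F (v n), F (u n)]])
      (x `^ (a - 1) * expR (- x))%:E @[n --> \oo] -->
    \int[lebesgue_measure]_(x in \bigcup_n [set` `[F (v n), F (u n)]])
      (x `^ (a - 1) * expR (- x))%:E)%E.
  apply: ge0_nondecreasing_set_cvg_integral => //.
  - move=> n m nm; apply/subsetPset => x /=; rewrite !in_itv/= => /andP[x1 x2].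
    by rewrite (le_trans _ x1) ?(le_trans x2)//; apply: leF; [exact: nu|exact: nv].
  - by move=> n; exact: measurable_funTS.
  - by move=> n x _; rewrite lee_fin mulr_ge0 ?powR_ge0 ?expR_ge0.
have cvgB : (\int[lebesgue_measure]_(y in [set` `[u n, v n]]) (K y)%:E
    @[n --> \oo] -->
    \int[lebesgue_measure]_(y in \bigcup_n [set` `[u n, v n]]) (K y)%:E)%E.
  apply: ge0_nondecreasing_set_cvg_integral => //.
  - move=> n m nm; apply/subsetPset => x /=; rewrite !in_itv/= => /andP[x1 x2].
    by rewrite (le_trans _ x1) ?(le_trans x2)//; [exact: nv|exact: nu].
  - by move=> n; exact: measurable_funTS.
  - by move=> n x _; rewrite lee_fin.
rewrite [X in (X @ _ --> _)%E](_ : _ = fun n =>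
  \int[lebesgue_measure]_(y in [set` `[u n, v n]]) (K y)%:E)%E in cvgA.
  exact: (cvg_unique _ cvgA cvgB).
by apply/funext => n; exact: integral_gamma_itv.
Qed.

Let FE y : F y = expR (ln b - 2 * y).
Proof. by rewrite expRD lnK ?posrE. Qed.

Lemma lower_gammaE :
  lower_gamma a b =
  (\int[lebesgue_measure]_(y in `[0%R, +oo[)
    (2 * (b * expR (- (2 * y))) `^ a * expR (- (b * expR (- (2 * y)))))%:E)%E.
Proof.
(* [F] never takes the value 0, so this null point is removed before exhausting []0, b]]. *)
rewrite /lower_gamma -integral_itv_obnd_cbnd; last exact: measurable_funTS.
apply: (@gamma_limit (fun=> 0) (fun n => n%:R)).
- by [].
- by [].
- by move=> n; rewrite ler_nat.
- rewrite F0; apply/seteqP; split => [x [n _] /=|x /=]; rewrite !in_itv/=.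
    by move=> /andP[x1 ->]; rewrite (lt_le_trans _ x1).
  move=> /andP[x0 xb].
  have lxb : ln x <= ln b by rewrite ler_ln ?posrE.
  (* [F N <= x] amounts to [2 N >= ln b - ln x]; any [N] above this nonnegative difference will
     do. *)
  have := Num.Theory.truncnS_gt (ln b - ln x).
  set N := (Num.truncn _).+1 => ltN; exists N => //=.
  rewrite in_itv/= xb andbT FE -[leRHS]lnK ?posrE// ler_expR.
  lra.
- apply/seteqP; split => [x [n _] /=|x /=]; rewrite !in_itv/= ?andbT.
    by move=> /andP[].
  move=> x0; exists (Num.truncn x).+1 => //=; rewrite in_itv/= x0/=.
  exact/ltW/Num.Theory.truncnS_gt.
Qed.

Lemma upper_gammaE :
  upper_gamma a b =
  (\int[lebesgue_measure]_(y in `]-oo, 0%R])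
    (2 * (b * expR (- (2 * y))) `^ a * expR (- (b * expR (- (2 * y)))))%:E)%E.
Proof.
apply: (@gamma_limit (fun n => - n%:R) (fun=> 0)).
- by move=> n; rewrite oppr_le0.
- by move=> n; rewrite lerN2 ler_nat.
- by [].
- rewrite F0; apply/seteqP; split => [x [n _] /=|x /=]; rewrite !in_itv/= ?andbT.
    by move=> /andP[].
  move=> bx.
  have x0 : 0 < x by exact: lt_le_trans bx.
  have lbx : ln b <= ln x by rewrite ler_ln ?posrE.
  (* Here [x <= F (- N)] amounts to [ln x - ln b <= 2 N], and the difference is again
     nonnegative. *)
  have := Num.Theory.truncnS_gt (ln x - ln b).
  set N := (Num.truncn _).+1 => ltN; exists N => //=.
  rewrite in_itv/= bx/= FE -[leLHS]lnK ?posrE// ler_expR.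
  lra.
- apply/seteqP; split => [x [n _] /=|x /=]; rewrite !in_itv/= ?andbT.
    by move=> /andP[].
  move=> x0; exists (Num.truncn (- x)).+1 => //=; rewrite in_itv/= x0/= andbT.
  by rewrite lerNl; exact/ltW/Num.Theory.truncnS_gt.
Qed.

End gamma_substitution.

(** * The density as an integral of the mixture kernel *)

(* [d = D^-1] gives the integrand of the upper gamma term, [d = - D^-1] that of
   the lower one. *)
Lemma eps_density_kernel {R : realType} (D c e d y : R) : 0 < D -> e != 0 ->
  (4 * Num.sqrt pi * D)^-1 * (Num.sqrt 2 * expR c) `^ (- d) *
  (2 * (e ^+ 2 / (2 * expR (2 * c)) * expR (- (2 * y))) `^ ((1 - d) / 2) *
     expR (- (e ^+ 2 / (2 * expR (2 * c)) * expR (- (2 * y))))) *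
  `|e| `^ (d - 1) =
  (2 * D)^-1 * expR (d * y) *
    (normal_pdf 0 1 (e / expR (c + y)) / expR (c + y)).
Proof.
move=> D0 e0.
have q0 : 0 < Num.sqrt 2 :> R by rewrite sqrtr_gt0.
have p0 : 0 < Num.sqrt pi :> R by rewrite sqrtr_gt0 pi_gt0.
(* With [sqrt 2], [|e|] and the gamma argument written as exponentials, every real power becomes a
   product in an exponent. *)
pose r : R := ln (Num.sqrt 2).
have rE : Num.sqrt 2 = expR r :> R by rewrite lnK.
have rE2 : 2 = expR (2 * r) :> R.
  by rewrite mulr_natl mulr2n expRD -rE -expr2 sqr_sqrtr.
have eE : `|e| = expR (ln `|e|) by rewrite lnK// posrE normr_gt0.
have wE : e ^+ 2 / (2 * expR (2 * c)) * expR (- (2 * y)) =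
    expR (2 * (ln `|e| - (r + c) - y)).
  rewrite -real_normK ?num_real// {1}eE [X in _ / (X * _)]rE2.
  rewrite -expRM_natl -!expRD -expRN -!expRD.
  by congr expR; ring.
have nE : normal_pdf 0 1 (e / expR (c + y)) =
    (Num.sqrt pi)^-1 * expR (- r) *
    expR (- (e ^+ 2 / (2 * expR (2 * c)) * expR (- (2 * y)))).
  rewrite normal_pdfE ?oner_neq0///= /normal_peak /normal_fun.
  congr (_ * expR _).
    by rewrite expr1n mul1r -mulr_natr sqrtrM ?pi_ge0// rE invfM expRN.
  rewrite subr0 expr1n exprMn exprVn -expRM_natl mulrDr expRD expRN.
  by field; rewrite !gt_eqF ?expR_gt0.
rewrite nE rE eE wE -expRD -!expRM -expRN.
(* The factors common to both sides, including the double exponential, are isolated; what remains is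
   a linear identity between exponents. *)
transitivity ((2 * D)^-1 * (Num.sqrt pi)^-1 *
    expR (- expR (2 * (ln `|e| - (r + c) - y))) * expR (d * y - r - (c + y)));
    last first.
  by rewrite !expRD; ring.
transitivity ((2 * D)^-1 * (Num.sqrt pi)^-1 *
    expR (- expR (2 * (ln `|e| - (r + c) - y))) *
    (expR ((r + c) * - d) * expR (2 * (ln `|e| - (r + c) - y) * ((1 - d) / 2)) *
     expR (ln `|e| * (d - 1)))).
  by field; rewrite !gt_eqF.
by rewrite -!expRD; congr (_ * expR _); field.
Qed.

(** The joint density at [(y, e)] of [h] and [exp (c + h) z], for [h] Laplace and [z] standard
    normal independent of [h]. *)
Definition eps_mixture {R : realType} (D c e y : R) : R :=
  laplace_pdf D y * (normal_pdf 0 1 (e / expR (c + y)) / expR (c + y)).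

Lemma eps_mixture_ge0 {R : realType} (D c e y : R) :
  0 < D -> 0 <= eps_mixture D c e y.
Proof.
move=> D0; rewrite /eps_mixture /laplace_pdf.
have := normal_pdf_ge0 0 1 (e / expR (c + y)) => n0.
by rewrite !(mulr_ge0, invr_ge0, expR_ge0, n0)// ltW.
Qed.

Lemma measurable_laplace_pdf {R : realType} (D : R) :
  measurable_fun setT (laplace_pdf D).
Proof.
apply: measurable_funM => //; apply: measurableT_comp => //.
by apply: measurable_funM => //; exact: measurableT_comp.
Qed.

Lemma measurable_eps_mixture {R : realType} (D c : R) :
  measurable_fun setT (fun x : R * R => eps_mixture D c x.2 x.1).
Proof.
apply: measurable_funM.
  by apply: measurableT_comp => //; exact: measurable_laplace_pdf.
have msV : measurable_fun setT (fun x : R * R => (expR (c + x.1))^-1).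
  rewrite (_ : (fun _ => _) = (fun x : R * R => expR (- (c + x.1)))); last first.
    by apply/funext => x; rewrite expRN.
  apply: measurableT_comp => //; apply: measurableT_comp => //.
  exact: measurable_funD.
apply: measurable_funM => //.
apply: (measurableT_comp (measurable_normal_pdf 0 1)).
exact: measurable_funM.
Qed.

(** The line is split at 0, where [|y|] changes sign: the kernel identity with [d = D^-1] applies on
    the left and with [d = - D^-1] on the right. The condition [e != 0] makes the gamma argument [b]
    positive. *)
Lemma eps_densityE {R : realType} (D c e : R) : 0 < D -> e != 0 ->
  (eps_density D c e =
   \int[lebesgue_measure]_y (eps_mixture D c e y)%:E)%E.
Proof.
move=> D0 e0.
have b0 : 0 < e ^+ 2 / (2 * expR (2 * c)).
  by apply: divr_gt0; [rewrite exprn_even_gt0|rewrite mulr_gt0 ?expR_gt0].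
have mk : measurable_fun setT (fun y => (eps_mixture D c e y)%:E).
  apply/measurable_EFinP.
  apply: (measurableT_comp (measurable_eps_mixture D c)
    (_ : measurable_fun _ (fun y => (y, e)))).
  exact: measurable_fun_pair.
pose K a y : R := 2 * (e ^+ 2 / (2 * expR (2 * c)) * expR (- (2 * y))) `^ a *
  expR (- (e ^+ 2 / (2 * expR (2 * c)) * expR (- (2 * y)))).
have mK a : measurable_fun setT (fun y => (K a y)%:E).
  have mF : measurable_fun setT (fun y : R =>
     (e ^+ 2 / (2 * expR (2 * c)) * expR (- (2 * y)))).
    apply: measurable_funM => //; apply: measurableT_comp => //.
    by apply: measurableT_comp => //; exact: measurable_funM.
  apply/measurable_EFinP; apply: measurable_funM; last first.
    by apply: measurableT_comp => //; exact: measurableT_comp.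
  apply: measurable_funM => //.
  exact: (measurableT_comp (measurable_powR _)).
have K0 a y : (0 <= (K a y)%:E)%E.
  by rewrite lee_fin !mulr_ge0 ?expR_ge0 ?powR_ge0.
have C0 d : 0 <= (4 * Num.sqrt pi * D)^-1 * (Num.sqrt 2 * expR c) `^ d.
  by rewrite mulr_ge0 ?powR_ge0// invr_ge0 !mulr_ge0 ?sqrtr_ge0// ltW.
have pullE (k k' : R) (A : set R) a : 0 <= k -> 0 <= k' -> measurable A ->
    (k%:E * \int[lebesgue_measure]_(y in A) (K a y)%:E * k'%:E =
     \int[lebesgue_measure]_(y in A) (k * K a y * k')%:E)%E.
  move=> k0 k'0 mA.
  rewrite -ge0_integralZl_EFin//; last exact: (measurable_funTS (mK a)).
  rewrite -ge0_integralZr// ?lee_fin//.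
    by apply: emeasurable_funM => //; exact: (measurable_funTS (mK a)).
  by move=> y _; rewrite mule_ge0.
rewrite /eps_density lower_gammaE// upper_gammaE// !pullE ?powR_ge0//.
rewrite -[in RHS](setUv `]-oo, (0:R)]%classic) setCitvl.
rewrite [in RHS]ge0_integral_setU//; last 3 first.
- exact: measurable_funTS.
- by move=> y _; rewrite lee_fin eps_mixture_ge0.
- by rewrite -setCitvl; exact/disj_setPCl.
(* The complement of []-oo, 0]] is open at 0, while the lower gamma term is an integral over [[0,
   +oo[]; the endpoint is null. *)
rewrite integral_itv_obnd_cbnd; last exact: measurable_funTS.
congr (_ + _)%E; apply: eq_integral => y; rewrite inE/= in_itv/= => y0.
  rewrite eps_density_kernel// /eps_mixture /laplace_pdf.
  by rewrite ler0_norm// opprK [y / D]mulrC.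
have := eps_density_kernel D c e (- D^-1) y D0 e0; rewrite !opprK => ->.
move: y0; rewrite andbT => y0.
by rewrite /eps_mixture /laplace_pdf ger0_norm// !mulNr [y / D]mulrC.
Qed.

(** * The law of [exp (c + y) z] for independent [y] and [z] *)

Lemma scale_mixture_law {R : realType} (D c : R)
    (LY LZ : probability (measurableTypeR R) R) (B : set R) :
  0 < D -> measurable B ->
  (forall A, measurable A ->
    LY A = \int[lebesgue_measure]_(x in A) (laplace_pdf D x)%:E)%E ->
  (forall A, measurable A ->
    LZ A = \int[lebesgue_measure]_(x in A) (normal_pdf 0 1 x)%:E)%E ->
  ((LY \x LZ) [set yz | B (expR (c + yz.1) * yz.2)%R] =
   \int[lebesgue_measure]_(x in B) eps_density D c x)%E.
Proof.
move=> D0 mB LYE LZE.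
have laplace0 y : 0 <= laplace_pdf D y.
  by rewrite /laplace_pdf mulr_ge0 ?expR_ge0// invr_ge0 mulr_ge0// ltW.
have mS : measurable [set yz : R * R | B (expR (c + yz.1) * yz.2)].
  have mf : measurable_fun setT (fun yz : R * R => expR (c + yz.1) * yz.2).
    apply: measurable_funM => //; apply: measurableT_comp => //.
    exact: measurable_funD.
  by rewrite -[X in measurable X]setTI; exact: mf.
have mix x y : (0 <= (eps_mixture D c x y)%:E)%E.
  by rewrite lee_fin eps_mixture_ge0.
(* Extending the kernel by 0 outside [B] turns the integral over [B] into one over the whole plane,
   ready for Tonelli. *)
pose f (p : R * R) := ((fun x => (eps_mixture D c x p.1)%:E) \_ B) p.2.
have f0 p : (0 <= f p)%E.
  by rewrite /f /patch; case: ifPn => // _; exact: mix.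
have mf : measurable_fun setT f.
  rewrite (_ : f = fun p => ((\1_B p.2 * eps_mixture D c p.2 p.1)%:E)).
    apply/measurable_EFinP; apply: measurable_funM.
      by apply: measurableT_comp => //; exact: measurable_indic.
    exact: measurable_eps_mixture.
  apply/funext => p; rewrite /f patchE indicE.
  by case: ifPn => _; rewrite ?mul1r ?mul0r.
transitivity (\int[lebesgue_measure]_y \int[lebesgue_measure]_x f (y, x))%E.
  rewrite /product_measure1.
  rewrite (ge0_integral_density lebesgue_measure LY (laplace_pdf D))//; last 2 first.
  - exact: measurable_laplace_pdf.
  - exact: measurable_fun_xsection.
  apply: eq_integral => y _; rewrite -integral_mkcond/=.
  pose s := expR (c + y); have s0 : 0 < s by exact: expR_gt0.
  rewrite (_ : xsection _ y = (fun z => s * z) @^-1` B); last first.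
    by apply/seteqP; split => z; rewrite /xsection/= inE.
  have mn : measurable_fun setT (fun x : R => (normal_pdf 0 1 (x / s))%:E).
    apply/measurable_EFinP; apply: (measurableT_comp (measurable_normal_pdf 0 1)).
    exact: measurable_funM.
  have n0 x : (0 <= (normal_pdf 0 1 (x / s))%:E)%E.
    by rewrite lee_fin normal_pdf_ge0.
  (* Scaling is applied to [x -> phi (x / s)], whose value at [s z] is [phi z]; this yields the
     density [phi (x / s) / s]. *)
  have := @ge0_integral_scale _ s _ B s0 mB mn n0.
  rewrite LZE; last first.
    rewrite -[X in measurable X]setTI.
    have : measurable_fun setT (fun z : R => s * z) by exact: measurable_funM.
    exact.
  under eq_integral do rewrite mulrAC divff ?gt_eqF// mul1r.
  move=> ->.
  rewrite -ge0_integralZl_EFin//; last 2 first.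
    exact: measurable_funTS.
    by rewrite invr_ge0 ltW.
  rewrite -ge0_integralZr//; last 3 first.
    by apply: emeasurable_funM => //; exact: measurable_funTS.
    by move=> x _; rewrite mule_ge0// lee_fin invr_ge0 ltW.
    by rewrite lee_fin.
  apply: eq_integral => x _; rewrite -!EFinM; congr EFin.
  by rewrite /eps_mixture mulrC [s^-1 * _]mulrC.
rewrite (@fubini_tonelli _ _ (measurableTypeR R) (measurableTypeR R) R
  lebesgue_measure lebesgue_measure f mf f0).
transitivity (\int[lebesgue_measure]_(x in B)
    \int[lebesgue_measure]_y (eps_mixture D c x y)%:E)%E.
  rewrite [RHS]integral_mkcond; apply: eq_integral => x _.
  rewrite patchE; case: ifPn => xB.
    by apply: eq_integral => y _; rewrite /f patchE/= xB.
  by apply: integral0_eq => y _; rewrite /f patchE/= (negbTE xB).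
have mg : measurable_fun setT
    (fun x => \int[lebesgue_measure]_y (eps_mixture D c x y)%:E)%E.
  have mmix : measurable_fun setT
      (fun p : R * R => (eps_mixture D c p.2 p.1)%:E).
    by apply/measurable_EFinP; exact: measurable_eps_mixture.
  exact: (@measurable_fun_fubini_tonelli_G _ _ (measurableTypeR R)
    (measurableTypeR R) R lebesgue_measure _ mmix (fun p => mix _ _)).
(* The formula for the density is available only off 0, so the null point 0 is removed from [B] and
   restored afterwards. Measurability of [eps_density] off 0 is inherited from the mixture
   integral. *)
have gE x : x \in B `\ 0 -> (\int[lebesgue_measure]_y (eps_mixture D c x y)%:E =
    eps_density D c x)%E.
  by rewrite inE => -[_ /= /eqP x0]; rewrite eps_densityE.
have mB0 : measurable (B `\ 0) by exact: measurableD.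
rewrite -(@integral_setD1 _ _ 0)//; last exact: measurable_funTS.
transitivity (\int[lebesgue_measure]_(x in B `\ 0%R) eps_density D c x)%E.
  exact: eq_integral.
apply: integral_setD1 => //; apply: (eq_measurable_fun _ gE).
exact: measurable_funTS.
Qed.

(** * Joint laws from independence *)

(** The law of [(X, Y)] agrees on rectangles with the product of the law of [X] and [nu], hence
    everywhere. As [mu] is only assumed finite, it may be a probability restricted to an event. *)
Lemma product_law {d d1 d2} {T : measurableType d} {T1 : measurableType d1}
    {T2 : measurableType d2} {R : realType} (mu : {finite_measure set T -> \bar R})
    (X : T -> T1) (Y : T -> T2) (nu : {sigma_finite_measure set T2 -> \bar R})
    (S : set (T1 * T2)) :
  measurable_fun setT X -> measurable_fun setT Y ->
  (forall B C, measurable B -> measurable C ->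
    mu (X @^-1` B `&` Y @^-1` C) = mu (X @^-1` B) * nu C)%E ->
  measurable S ->
  (mu [set w | S (X w, Y w)] = \int[mu]_w nu (xsection S (X w)))%E.
Proof.
move=> mX mY indep mS.
pose m1 : {measure set T1 -> \bar R} :=
  measure_function_pushforward__canonical__measure_function_Measure mu mX.
have fin_m1 : fin_num_fun m1.
  move=> B mB; apply: fin_num_measure; rewrite -[X in measurable X]setTI.
  exact: (mX measurableT B mB).
(* Uniqueness of product measures needs the law of [X] as a finite measure, not just as a
   measure. *)
pose m1f := HB.pack_for {finite_measure set T1 -> \bar R} (pushforward mu X)
  (Measure.class m1) (Measure_isFinite.Build _ _ _ m1 fin_m1).
have mXY : measurable_fun setT (fun w => (X w, Y w)) by exact: measurable_fun_pair.
pose m' : {measure set (T1 * T2) -> \bar R} :=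
  measure_function_pushforward__canonical__measure_function_Measure mu mXY.
have /esym := @product_measure_unique _ _ _ _ _ (m1f mX) nu m' indep S mS.
rewrite /product_measure1/= => mE; rewrite [LHS]mE.
rewrite ge0_integral_pushforward//; exact: measurable_fun_xsection.
Qed.

(** Independence gives the claim on rectangles; uniqueness of the product measure extends it to all
    [S], with the constant [P A] absorbed into the first factor. *)
Lemma indep_pair_sigma_law {d} {T : measurableType d} {R : realType}
    (P : probability T R) (G : set (set T)) (Y Z : {mfun T >-> measurableTypeR R})
    (A : set T) (S : set (measurableTypeR R * measurableTypeR R)) :
  indep_pair_sigma P G Y Z -> G A -> measurable A -> measurable S ->
  (P (A `&` [set w | S (Y w, Z w)]) =
   P A * (distribution P Y \x distribution P Z) S)%E.
Proof.
move=> indep GA mA mS.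
have PA0 : 0 <= fine (P A) by rewrite fine_ge0.
pose k := NngNum PA0.
have kE : k%:num%:E = P A by rewrite /= fineK// fin_num_measure.
have mYZ : measurable_fun setT (fun w => (Y w, Z w)).
  by apply: measurable_fun_pair.
pose m' : {measure set (measurableTypeR R * measurableTypeR R) -> \bar R} :=
  measure_function_pushforward__canonical__measure_function_Measure
    (mrestr P mA) mYZ.
have m'E B C : measurable B -> measurable C ->
    (m' (B `*` C) = mscale k (distribution P Y) B * distribution P Z C)%E.
  move=> mB mC; rewrite /m'/= /pushforward/= /mrestr/= /mscale kE.
  by rewrite -(indep A B C)//; congr (P _); rewrite setIC -setIA.
have := product_measure_unique m'E mS.
rewrite /product_measure1 ge0_integral_mscale//; last first.
  exact: measurable_fun_xsection.
rewrite kE => ->.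
by rewrite /m'/= /pushforward/= /mrestr/= setIC.
Qed.

(** * The conditional density given the past *)

Theorem theorem2p1 (d : measure_display) (T : measurableType d) (R : realType)
  (P : probability T R) (F : nat -> set (set T))
  (Hbar h z : nat -> T -> R) (D : R) (t : nat) :
  filtration F ->
  (0 < D)%R ->
  (forall n, measurable_fun setT (h n)) ->
  (forall n, measurable_fun setT (z n)) ->
  (forall n, has_density P (h n) (laplace_pdf D)) ->
  indep_seq P h ->
  (forall n, has_density P (z n) (normal_pdf 0 1)) ->
  indep_seq P z ->
  (forall n, (0 < n)%N -> G_measurable (F n.-1) (Hbar n)) ->
  (forall n, (0 < n)%N -> indep_pair_sigma P (F n.-1) (h n) (z n)) ->
  (0 < t)%N ->
  forall (A : set T) (B : set R), F t.-1 A -> measurable B ->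
    P (A `&` (fun w => expR (Hbar t w + h t w) * z t w) @^-1` B) =
    (\int[P]_(w in A)
       \int[lebesgue_measure]_(x in B) eps_density D (Hbar t w) x)%E.
Proof.
move=> [subF _] D0 mh mz hpdf _ zpdf _ HbarF indepF t0 A B FA mB.
set G := F t.-1 in FA.
have [sigG Gm] : sub_sigma G := subF t.-1.
have setIG : setI_closed G by have /sigma_algebraP[] := sigG.
have mA : measurable A by exact: Gm.
pose X : T -> measurableTypeR R := Hbar t.
have XG : forall C : set R, measurable C -> G (X @^-1` C) by exact: HbarF.
have mX : measurable_fun setT X.
  by move=> _ C mC; rewrite setTI; exact/Gm/XG.
have mY : measurable_fun setT (h t : T -> measurableTypeR R) by exact: mh.
have mZ : measurable_fun setT (z t : T -> measurableTypeR R) by exact: mz.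
pose Y : {mfun T >-> measurableTypeR R} :=
  HB.pack (h t : T -> measurableTypeR R) (isMeasurableFun.Build _ _ _ _ _ mY).
pose Z : {mfun T >-> measurableTypeR R} :=
  HB.pack (z t : T -> measurableTypeR R) (isMeasurableFun.Build _ _ _ _ _ mZ).
have indepYZ : indep_pair_sigma P G Y Z := indepF t t0.
pose LY : subprobability (measurableTypeR R) R := distribution P Y.
pose LZ : subprobability (measurableTypeR R) R := distribution P Z.
pose nu := product_subprobability (LY, LZ).
(* The past variable is kept as a separate coordinate: the section of [S] at [X w] is the event of
   the scale mixture with [c = Hbar t w]. *)
pose S : set (measurableTypeR R * (measurableTypeR R * measurableTypeR R)) :=
  [set p | B (expR (p.1 + p.2.1) * p.2.2)].
have mS : measurable S.
  have mf : measurable_fun setT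
      (fun p : R * (R * R) => expR (p.1 + p.2.1) * p.2.2).
    apply: measurable_funM.
      apply: measurableT_comp => //; apply: measurable_funD => //.
      exact: (measurableT_comp measurable_fst).
    exact: (measurableT_comp measurable_snd).
  by rewrite -[X in measurable X]setTI; exact: mf.
have nuE w : (nu (xsection S (X w)) =
    \int[lebesgue_measure]_(x in B) eps_density D (Hbar t w) x)%E.
  rewrite -(@scale_mixture_law _ D (Hbar t w)
    (distribution P Y) (distribution P Z))//.
  - by congr (nu _); apply/seteqP; split => yz; rewrite /xsection/= inE.
  - exact: (hpdf t).
  - exact: (zpdf t).
have mYZ : measurable_fun setT (fun w => (Y w, Z w)).
  exact: measurable_fun_pair.
(* Restricting [P] to [A] builds the conditioning event into the measure. *)
have law := @product_law _ _ _ T _ _ R (mrestr P mA) X (fun w => (Y w, Z w)) nu S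
  mX mYZ _ mS.
transitivity (mrestr P mA [set w | S (X w, (Y w, Z w))]).
  by rewrite /mrestr setIC.
rewrite law; last first.
  move=> C E mC mE; rewrite /mrestr.
  (* An event of [X] intersected with [A] still belongs to the past, so it is independent of the
     pair [(Y, Z)]. *)
  have GAC : G (X @^-1` C `&` A) by apply: setIG => //; exact: XG.
  have := indep_pair_sigma_law P G Y Z _ E indepYZ GAC (Gm _ GAC) mE.
  by rewrite setIAC.
have mnu : measurable_fun setT (fun w => nu (xsection S (X w))).
  exact: (measurableT_comp (measurable_fun_xsection nu mS) mX).
(* The restricted measure has density [\1_A] with respect to [P], which turns the integral into one
   over [A]. *)
rewrite (ge0_integral_density P (mrestr P mA) \1_A)//; last first.
  by move=> C mC; rewrite integral_indic// /mrestr setIC.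
rewrite [RHS]integral_mkcond; apply: eq_integral => w _.
rewrite patchE indicE; case: ifPn => _; last by rewrite mule0.
by rewrite mule1; exact: nuE.
Qed.
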